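(* Let $k\geq 2$ and let $\varphi\colon\mathcal{A}\to\mathcal{A}^*$ be a (growing) substitution of constant length $k$ on a finite alphabet $\mathcal{A}$. Let $Y\subset\mathcal{B}^{\mathbf{Z}}$ be a subshift and let $\pi\colon X_{\varphi}\to Y$ be a factor map. Then: (1) A sequence $y\in Y$ is $k$-automatic if and only if $y=\pi(x)$ for some quasi-fixed point $x$ of $\varphi$ (with $x\in X_\varphi$). (2) If $y\in Y$ is $k$-automatic and nonperiodic, then every point of $\pi^{-1}(y)\subset X_\varphi$ is a quasi-fixed point of $\varphi$.
   Context: A substitution $\varphi\colon\mathcal{A}\to\mathcal{A}^*$ assigns to each letter a finite word; it is assumed growing, i.e. $|\varphi^n(a)|\to\infty$ for every $a\in\mathcal{A}$; it has constant length $k$ if $|\varphi(a)|=k$ for all $a$. It acts on $\mathcal{A}^{\mathbf{Z}}$ by concatenation: $\varphi(\ldots x_{-1}.x_0x_1\ldots)=\ldots\varphi(x_{-1}).\varphi(x_0)\varphi(x_1)\ldots$, where the dot marks position $0$. $T$ denotes the shift $(Tx)_n=x_{n+1}$ on $\mathcal{A}^{\mathbf{Z}}$. $X_\varphi=\{x\in\mathcal{A}^{\mathbf{Z}}:$ every finite factor of $x$ appears in $\varphi^n(a)$ for some $a\in\mathcal{A}$, $n\geq 0\}$. A subshift is a closed shift-invariant subset of $\mathcal{B}^{\mathbf{Z}}$ ($\mathcal{B}$ finite); a factor map is a continuous surjection commuting with the shifts. A point $y$ is periodic if $T^p y=y$ for some $p\geq 1$. A point $z\in\mathcal{A}^{\mathbf{Z}}$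 is a quasi-fixed point of $\varphi$ if $T^c(\varphi^m(z))=z$ for some $m\geq 1$, $c\in\mathbf{Z}$. A two-sided sequence is $k$-automatic if it is the image under a coding (letter-to-letter map) of a two-sided fixed point of some substitution of constant length $k$; equivalently, both one-sided sequences $(y_n)_{n\geq 0}$ and $(y_{-n-1})_{n\geq 0}$ are $k$-automatic in the usual sense. *)

(* Defs.v *)
From mathcomp Require Import all_boot all_algebra.
Set Implicit Arguments. Unset Strict Implicit. Unset Printing Implicit Defensive.
Import GRing.Theory Num.Theory.
Local Open Scope ring_scope.

Definition shiftz (S : Type) (c : int) (x : int -> S) : int -> S := fun n => x (n + c).

Definition subst_word (A : Type) (phi : A -> seq A) (w : seq A) : seq A :=
  flatten (map phi w).

Definition constant_length (A : Type) (k : nat) (phi : A -> seq A) : Prop :=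
  forall a, size (phi a) = k.

Definition growing (A : Type) (phi : A -> seq A) : Prop :=
  forall (a : A) (M : nat), exists n0 : nat, forall n : nat, (n0 <= n)%N ->
    (M <= size (iter n (subst_word phi) [:: a]))%N.

(* action on A^Z of a substitution of constant length k, by concatenation:
   phi(x) = ... phi(x_{-1}) . phi(x_0) phi(x_1) ..., so that
   phi(x)_{k q + r} = (phi(x_q))_r for 0 <= r < k. *)
Definition subst_seq (A : Type) (k : nat) (phi : A -> seq A) (x : int -> A) : int -> A :=
  fun m => nth (x (m %/ k%:Z)%Z) (phi (x (m %/ k%:Z)%Z)) `|(m %% k%:Z)%Z|%N.

Definition factor (A : Type) (x : int -> A) (i : int) (l : nat) : seq A :=
  mkseq (fun j => x (i + j%:Z)) l.

Definition X_sub (A : eqType) (phi : A -> seq A) (x : int -> A) : Prop :=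
  forall (i : int) (l : nat), exists (a : A) (n : nat),
    infix (factor x i l) (iter n (subst_word phi) [:: a]).

Definition agree_on (S : Type) (N : nat) (x x' : int -> S) : Prop :=
  forall n : int, (`|n|%N <= N)%N -> x n = x' n.

Definition subshift (B : Type) (Y : (int -> B) -> Prop) : Prop :=
  (forall y, (forall N : nat, exists y', Y y' /\ agree_on N y y') -> Y y) /\
  (forall y, Y y -> Y (shiftz 1 y)) /\
  (forall y, Y y -> exists y', Y y' /\ shiftz 1 y' = y).

(* factor map pi : X -> Y (pi is given on all of A^Z but only its restriction to X matters) *)
Definition factor_map (A B : Type) (X : (int -> A) -> Prop) (Y : (int -> B) -> Prop)
  (pi : (int -> A) -> (int -> B)) : Prop :=
  (forall x, X x -> Y (pi x)) /\
  (forall y, Y y -> exists x, X x /\ pi x = y) /\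
  (forall x, X x -> forall n : int, exists N : nat,
      forall x', X x' -> agree_on N x x' -> pi x' n = pi x n) /\
  (forall x, X x -> pi (shiftz 1 x) = shiftz 1 (pi x)).

Definition periodic (S : Type) (y : int -> S) : Prop :=
  exists p : nat, (1 <= p)%N /\ shiftz p%:Z y = y.

Definition quasi_fixed (A : Type) (k : nat) (phi : A -> seq A) (z : int -> A) : Prop :=
  exists (m : nat) (c : int), (1 <= m)%N /\ shiftz c (iter m (subst_seq k phi) z) = z.

Definition automatic (B : Type) (k : nat) (y : int -> B) : Prop :=
  exists (C : finType) (tau : C -> seq C) (z : int -> C) (f : C -> B),
    constant_length k tau /\ subst_seq k tau z = z /\ (forall n, y n = f (z n)).

(* Main.v *)
Require Import Defs.
From mathcomp Require Import all_boot all_algebra.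
From mathcomp Require Import zify boolp.
Set Implicit Arguments. Unset Strict Implicit. Unset Printing Implicit Defensive.

(** Write x = T^{c_i} phi^i(x_i) with 0 <= c_i < k^i by iterated desubstitution.
For a k-automatic y, the set W_i = {w : pi(T^{c_i} phi^i(w)) = y} is cut out by a
local rule taken from a finite list that does not depend on i, so W_i = W_j for
some i < j. The map Psi = T^e phi^(j-i) with x_i = Psi(x_j) then preserves W_i,
and iterating it converges, along a subsequence, to a point fixed by a power of
Psi; this gives a quasi-fixed point above y. If y is not periodic, two distinct
shifts of one point cannot both lie in W_i, so any two such return maps commute.
Hence the digits of the desubstitution of x are eventually periodic, which leaves
only finitely many possible x_i and makes x quasi-fixed. *)

(** * Locality and composition of the maps T^c phi^i *)

Section SubstitutionMaps.
Import GRing.Theory Num.Theory.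
Local Open Scope ring_scope.

Lemma divz_modzE (K r : nat) (q : int) : (r < K)%N ->
  ((K%:Z * q + r%:Z) %/ K%:Z)%Z = q /\ ((K%:Z * q + r%:Z) %% K%:Z)%Z = r%:Z.
Proof.
move=> rK; have K0 : K%:Z != 0 by lia.
have r_small : (0 <= r%:Z < `|K%:Z|)%R by lia.
rewrite mulrC modzMDl divzMDl // (modz_small r_small).
by rewrite (divz_small r_small) addr0.
Qed.

Lemma divz_eq_nat (K : nat) (m : int) : (0 < K)%N ->
  exists (q : int) (r : nat), m = K%:Z * q + r%:Z /\ (r < K)%N.
Proof.
move=> K0; exists (m %/ K)%Z, `|(m %% K)%Z|%N.
have := modz_ge0 m (_ : K%:Z != 0); have := ltz_pmod m (_ : 0 < K%:Z).
move=> /(_ ltac:(lia)) rK /(_ ltac:(lia)) r0; split; last by lia.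
by rewrite gez0_abs // mulrC -divz_eq.
Qed.

Lemma agree_onW (S : Type) (M N : nat) (x y : int -> S) :
  (M <= N)%N -> agree_on N x y -> agree_on M x y.
Proof. by move=> MN xy n nM; apply: xy; apply: leq_trans MN. Qed.

Lemma agree_on_sym (S : Type) (N : nat) (x y : int -> S) :
  agree_on N x y -> agree_on N y x.
Proof. by move=> xy n nN; rewrite xy. Qed.

Lemma agree_on_trans (S : Type) (N : nat) (x y z : int -> S) :
  agree_on N x y -> agree_on N y z -> agree_on N x z.
Proof. by move=> xy yz n nN; rewrite xy ?yz. Qed.

Lemma agree_on_all (S : Type) (x y : int -> S) :
  (forall N, agree_on N x y) -> x = y.
Proof. by move=> xy; apply: funext => n; apply: (xy `|n|%N). Qed.

Lemma shiftzD (S : Type) (c d : int) (x : int -> S) :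
  shiftz c (shiftz d x) = shiftz (c + d) x.
Proof. by apply: funext => n; rewrite /shiftz addrA. Qed.

Lemma shiftz0 (S : Type) (x : int -> S) : shiftz 0 x = x.
Proof. by apply: funext => n; rewrite /shiftz addr0. Qed.

Definition shifted_iter (A : Type) (k : nat) (phi : A -> seq A) (i : nat)
  (c : int) (w : int -> A) : int -> A := shiftz c (iter i (subst_seq k phi) w).

Variables (A : Type) (k : nat) (phi : A -> seq A).
Hypotheses (k_gt1 : (2 <= k)%N) (phi_k : constant_length k phi).
Implicit Types w u : int -> A.
Local Notation op := (shifted_iter k phi).

Lemma subst_seqE w (q : int) (r : nat) a : (r < k)%N ->
  subst_seq k phi w (k%:Z * q + r%:Z) = nth a (phi (w q)) r.
Proof.
move=> rk; rewrite /subst_seq; have [-> ->] := divz_modzE q rk.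
by rewrite absz_nat; apply: set_nth_default; rewrite phi_k.
Qed.

(** Induction on [i], peeling off the outermost substitution: place t of a block of level [i.+1] is
    place t mod k in the image of letter t / k of the block of level [i]. *)
Lemma iter_subst_local i w u (q q' : int) (t : nat) :
  w q = u q' -> (t < k ^ i)%N ->
  iter i (subst_seq k phi) w ((k ^ i)%N%:Z * q + t%:Z) =
  iter i (subst_seq k phi) u ((k ^ i)%N%:Z * q' + t%:Z).
Proof.
move=> wu; elim: i t => [|i IH] t ti.
  have -> : t = 0%N by rewrite expn0 in ti; lia.
  by rewrite expn0 !mul1r !addr0.
have tE := divn_eq t k; set a := (t %/ k)%N in tE; set b := (t %% k)%N in tE.
have bk : (b < k)%N by rewrite ltn_mod; lia.
have ai : (a < k ^ i)%N by rewrite ltn_divLR -?expnSr //; lia.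
have splitE (q0 : int) : (k ^ i.+1)%N%:Z * q0 + t%:Z =
    k%:Z * ((k ^ i)%N%:Z * q0 + a%:Z) + b%:Z by rewrite expnS; lia.
rewrite !splitE /= !(subst_seqE _ _ (w q) bk); congr (nth _ (phi _) _).
exact: IH.
Qed.

Lemma shifted_iter_local i (c m : int) w u :
  (forall q : int, (k ^ i)%N%:Z * q <= m + c < (k ^ i)%N%:Z * (q + 1) ->
     w q = u q) ->
  op i c w m = op i c u m.
Proof.
move=> wu; have ki : (0 < k ^ i)%N by rewrite expn_gt0; lia.
have [q [t [mE ti]]] := divz_eq_nat (m + c) ki.
by rewrite /shifted_iter /shiftz mE; apply: iter_subst_local => //; apply: wu; lia.
Qed.

(** As c is reduced modulo k^i, m + c stays in (-k^i, 2 k^i), so only the letters at -1, 0, 1 are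
    read. The contraction arguments below rest on this. *)
Lemma shifted_iter_agree i (c : int) w u :
  0 <= c < (k ^ i)%N%:Z -> agree_on 1 w u ->
  forall m : int, (`|m|%N < k ^ i)%N -> op i c w m = op i c u m.
Proof.
move=> ci wu m mi; apply: shifted_iter_local => q qm; apply: wu.
nia.
Qed.

Lemma shifted_iter0 w : op 0 0 w = w.
Proof. exact: shiftz0. Qed.

Lemma subst_seq_shift (d : int) w :
  subst_seq k phi (shiftz d w) = shiftz (k%:Z * d) (subst_seq k phi w).
Proof.
apply: funext => m; have k0 : (0 < k)%N by lia.
have [q [r [-> rk]]] := divz_eq_nat m k0.
rewrite (subst_seqE _ _ (w 0) rk) /shiftz.
have -> : k%:Z * q + r%:Z + k%:Z * d = k%:Z * (q + d) + r%:Z by lia.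
by rewrite (subst_seqE _ _ (w 0) rk).
Qed.

Lemma iter_subst_shift i (d : int) w :
  iter i (subst_seq k phi) (shiftz d w) =
  shiftz ((k ^ i)%N%:Z * d) (iter i (subst_seq k phi) w).
Proof.
elim: i => [|i IH] /=; first by rewrite expn0 mul1r.
by rewrite IH subst_seq_shift expnS PoszM mulrA.
Qed.

Lemma shifted_iterD i j (c d : int) w :
  op i c (op j d w) = op (i + j) (c + (k ^ i)%N%:Z * d) w.
Proof. by rewrite /shifted_iter iter_subst_shift shiftzD iterD. Qed.

Lemma shifted_iter_shift i (c d : int) w :
  op i c (shiftz d w) = shiftz ((k ^ i)%N%:Z * d) (op i c w).
Proof. by rewrite /shifted_iter iter_subst_shift !shiftzD addrC. Qed.

Lemma shifted_iter_exp p (e : int) : 0 <= e < (k ^ p)%N%:Z ->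
  forall n, exists2 c : int, 0 <= c < (k ^ (p * n))%N%:Z &
    forall w, iter n (op p e) w = op (p * n) c w.
Proof.
move=> ep; elim=> [|n [c cn IH]].
  by exists 0; rewrite ?muln0 ?expn0 // => w; rewrite shifted_iter0.
exists (e + (k ^ p)%N%:Z * c); first by rewrite mulnS expnD; nia.
by move=> w; rewrite iterS IH shifted_iterD mulnS.
Qed.

Lemma iter_shifted_iter_agree p (e : int) n w u :
  (0 < p)%N -> 0 <= e < (k ^ p)%N%:Z -> agree_on 1 w u ->
  agree_on n (iter n (op p e) w) (iter n (op p e) u).
Proof.
move=> p0 ep wu m mn; have [c cn E] := shifted_iter_exp ep n.
rewrite !E; apply: shifted_iter_agree => //.
(* Here n < k^n <= k^(p n). *)
apply: leq_ltn_trans mn _; apply: leq_trans (ltn_expl n k_gt1) _.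
by rewrite leq_exp2l // leq_pmull.
Qed.

Lemma shifted_iter_cont i (c : int) N w u :
  agree_on (N + absz c) w u -> agree_on N (op i c w) (op i c u).
Proof.
move=> wu m mN; apply: shifted_iter_local => q qm; apply: wu.
have : (0 < k ^ i)%N by rewrite expn_gt0; lia.
nia.
Qed.

Lemma quasi_fixed_shifted_iter i (c : int) w :
  quasi_fixed k phi w -> quasi_fixed k phi (op i c w).
Proof.
(* The new shift c' solves c' + k^m c = c + k^i d, which makes T^c' phi^m T^c phi^i equal to T^c
   phi^i T^d phi^m. *)
move=> [m [d [m1 wE]]]; exists m, (c + (k ^ i)%N%:Z * d - (k ^ m)%N%:Z * c); split=> //.
have /= := shifted_iterD m i (c + (k ^ i)%N%:Z * d - (k ^ m)%N%:Z * c) c w.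
rewrite {1}/shifted_iter => ->; rewrite subrK addnC -shifted_iterD.
by congr shifted_iter.
Qed.

End SubstitutionMaps.

(** * Compactness of the full shift *)

Section Compactness.
Import GRing.Theory Num.Theory.
Local Open Scope ring_scope.

Lemma infinite_pigeonhole (T : finType) (P : nat -> Prop) (f : nat -> T) :
  (forall n0, exists n, (n0 <= n)%N /\ P n) ->
  exists a, forall n0, exists n, (n0 <= n)%N /\ P n /\ f n = a.
Proof.
move=> Pinf; apply: contrapT => /forallNP Pfin.
have /choice[g gP] (a : T) : exists n0, forall n, (n0 <= n)%N -> P n -> f n <> a.
  have /existsNP[n0 n0P] := Pfin a; exists n0 => n n0n Pn fn.
  by apply: n0P; exists n.
have [n [gn Pn]] := Pinf (\max_a g a)%N.
by apply: (gP (f n) n) => //; apply: leq_trans gn; apply: leq_bigmax.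
Qed.

(** Diagonal argument: a window occurring infinitely often is extended one radius at a time, by
    pigeonhole on the two new letters. The predicate [P] allows for a subsequence selected
    beforehand. *)
Lemma limit_point (A : finType) (s : nat -> int -> A) (P : nat -> Prop) :
  (forall n0, exists n, (n0 <= n)%N /\ P n) ->
  exists u, forall N n0, exists n, (n0 <= n)%N /\ P n /\ agree_on N u (s n).
Proof.
move=> Pinf.
pose Q N w := forall n0, exists n, (n0 <= n)%N /\ P n /\ agree_on N w (s n).
have [a aP] := infinite_pigeonhole (fun n => s n 0) Pinf.
have Q0 : Q 0%N (fun=> a).
  move=> n0; have [n [n0n [Pn sn]]] := aP n0; exists n; split=> //; split=> //.
  by move=> m m0; have -> : m = 0 by lia.
have /choice[g gP] (Nw : nat * (int -> A)) :
    exists w', Q Nw.1 Nw.2 -> Q Nw.1.+1 w' /\ agree_on Nw.1 Nw.2 w'.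
  case: Nw => N w /=; have [QNw|nQ] := pselect (Q N w); last by exists w.
  have [[b c] bcP] := infinite_pigeonhole (fun n => (s n N.+1%:Z, s n (- N.+1%:Z))) QNw.
  exists (fun m => if m == N.+1%:Z then b else if m == - N.+1%:Z then c else w m).
  move=> _; split=> [n0|m mN]; last by do 2 (case: eqP => [?|_]; first by lia).
  have [n [n0n [[Pn wn] [sb sc]]]] := bcP n0.
  exists n; split=> //; split=> // m mN.
  case: eqP => [->//|m1]; case: eqP => [->//|m2]; apply: wn; lia.
pose fix W N := if N is M.+1 then g (M, W M) else (fun=> a).
have QW N : Q N (W N) by elim: N => //= N IH; have [] := gP (N, W N) IH.
have WW N d : agree_on N (W N) (W (N + d)%N).
  elim: d => [|d IH]; first by rewrite addn0.
  rewrite addnS; apply: agree_on_trans IH _.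
  apply: (@agree_onW _ _ (N + d)); first by lia.
  by have [] := gP ((N + d)%N, W (N + d)%N) (QW _).
(* The windows are nested, so the limit can be read at [m] from the window of radius |m|. *)
exists (fun m => W `|m|%N m) => N n0.
have [n [n0n [Pn Wn]]] := QW N n0; exists n; split=> //; split=> // m mN.
rewrite -Wn // (WW _ (N - `|m|)%N) //.
by rewrite subnKC.
Qed.

(** Central blocks become elements of a finite type, so that pigeonhole applies to [agree_on]. *)
Definition window (A : finType) (N : nat) (w : int -> A) : {ffun 'I_(N + N).+1 -> A} :=
  [ffun j : 'I_(N + N).+1 => w ((j : nat)%:Z - N%:Z)].

Lemma windowP (A : finType) (N : nat) (w u : int -> A) :
  window N w = window N u <-> agree_on N w u.
Proof.
split=> [/ffunP wu m mN|wu].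
  have jP : (absz (m + N%:Z)%R < (N + N).+1)%N by lia.
  have := wu (Ordinal jP); rewrite !ffunE /=.
  by have -> : (absz (m + N%:Z))%:Z - N%:Z = m by lia.
by apply/ffunP => j; rewrite !ffunE; apply: wu; have := ltn_ord j; lia.
Qed.

End Compactness.

(** * Substitution and desubstitution inside the subshift *)

Section SubstitutionSubshift.
Import GRing.Theory Num.Theory.
Local Open Scope ring_scope.

Lemma infix_nthP (T : eqType) (a : T) (s t : seq T) :
  infix s t <-> exists p, (p + size s <= size t)%N /\
    forall j, (j < size s)%N -> nth a s j = nth a t (p + j).
Proof.
split=> [/infixP[s1 [s2 ->]]|[p [pt st]]].
  exists (size s1); rewrite !size_cat; split; first by lia.
  by move=> j js; rewrite nth_cat ltnNge leq_addr /= addKn nth_cat js.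
have -> : s = take (size s) (drop p t).
  apply: (@eq_from_nth _ a) => [|j js]; first by rewrite size_take_min size_drop; lia.
  by rewrite nth_take // nth_drop st.
apply/infixP; exists (take p t), (drop (size s) (drop p t)).
by rewrite !cat_take_drop.
Qed.

Lemma factor_infixP (T : eqType) (a : T) (x : int -> T) (i : int) (l : nat) (v : seq T) :
  infix (factor x i l) v <-> exists p, (p + l <= size v)%N /\
    forall j, (j < l)%N -> x (i + j%:Z) = nth a v (p + j).
Proof.
rewrite (infix_nthP a) size_mkseq.
by split=> -[p [pv xv]]; exists p; split=> // j jl; rewrite -xv // nth_mkseq.
Qed.

Variables (A : finType) (phi : A -> seq A).
Local Notation X := (X_sub phi).

Lemma X_sub_shift (c : int) x : X x -> X (shiftz c x).
Proof.
move=> Xx i l; have -> : factor (shiftz c x) i l = factor x (i + c) l.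
  by apply: eq_map => j; rewrite /shiftz addrAC.
exact: Xx.
Qed.

Lemma X_sub_closed x : (forall N, exists x', X x' /\ agree_on N x x') -> X x.
Proof.
move=> xX i l; have [x' [Xx' xx']] := xX (`|i| + l)%N.
have -> : factor x i l = factor x' i l; last exact: Xx'.
apply/eq_in_map => j; rewrite mem_iota => jl; apply: xx'; lia.
Qed.

Variable k : nat.
Hypotheses (k_gt1 : (2 <= k)%N) (phi_k : constant_length k phi).
Local Notation op := (shifted_iter k phi).

Lemma size_subst_word v : size (subst_word phi v) = (k * size v)%N.
Proof.
elim: v => [|b v IH]; first by rewrite muln0.
by rewrite /subst_word /= size_cat phi_k mulnS; congr addn.
Qed.

Lemma nth_subst_word a v q r : (q < size v)%N -> (r < k)%N ->
  nth a (subst_word phi v) (k * q + r) = nth a (phi (nth a v q)) r.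
Proof.
elim: v q => // b v IH [|q] qv rk; rewrite /subst_word /= nth_cat phi_k.
  by rewrite muln0 add0n rk.
rewrite mulnS -addnA ltnNge leq_addr /= addKn; exact: IH.
Qed.

Lemma X_sub_subst x : X x -> X (subst_seq k phi x).
Proof.
move=> Xx i l; have k0 : (0 < k)%N by lia.
have [q [r [-> rk]]] := divz_eq_nat i k0.
(* The l places from k q + r on lie over the l + 1 letters at q, ..., q + l. *)
have [b [n /(factor_infixP (x q))[p [pv xv]]]] := Xx q l.+1.
exists b, n.+1; apply/(factor_infixP (x q)); rewrite iterS.
set v : seq A := iter n (subst_word phi) [:: b] in pv xv *.
have {}pv : (p + l.+1 <= size v)%N := pv.
exists (k * p + r)%N; rewrite size_subst_word; split; first by nia.
move=> j jl; have := divn_eq (r + j) k.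
set e := ((r + j) %/ k)%N; set f := ((r + j) %% k)%N => rjE.
have fk : (f < k)%N by rewrite ltn_mod.
have el : (e < l.+1)%N by nia.
have -> : (k * p + r + j = k * (p + e) + f)%N by lia.
have -> : k%:Z * q + r%:Z + j%:Z = k%:Z * (q + e%:Z) + f%:Z by lia.
rewrite (subst_seqE phi_k _ _ (x q) fk) nth_subst_word //; last by lia.
by rewrite xv.
Qed.

Lemma X_sub_shifted_iter i (c : int) x : X x -> X (op i c x).
Proof.
move=> Xx; apply: X_sub_shift.
by elim: i => //= i; apply: X_sub_subst.
Qed.

(** A window of x occurs in phi(v) with v = phi^n(b); cutting it along the blocks phi(v_j) gives [d]
    and the letters of [u]. Only finite windows of [u] are controlled; membership in [X] is obtained
    in the limit. *)
Lemma X_sub_desubst_approx x N : X x -> exists (d : 'I_k) (u : int -> A),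
  agree_on N x (op 1 (d : nat)%:Z u) /\
  forall M, (k * M.+2 <= N)%N -> exists b n, infix (factor u (- M%:Z) (M + M).+1)
     (iter n (subst_word phi) [:: b]).
Proof.
move=> Xx; have k0 : (0 < k)%N by lia.
have [b [n]] := Xx (- N.+1%:Z) (N.+1 + N.+1).+1.
move=> /(factor_infixP (x 0))[p [pv xv]].
(* For n = 0 the word has one letter, too short for the window. *)
case: n pv xv => [|n] pv xv; first by move: pv => /=; lia.
rewrite iterS size_subst_word in pv.
set v : seq A := iter n (subst_word phi) [:: b] in pv xv.
have {}pv : (p + (N.+1 + N.+1).+1 <= k * size v)%N := pv.
have := divn_eq (p + N.+1) k; have := ltn_mod (p + N.+1) k.
set q := ((p + N.+1) %/ k)%N; set d := ((p + N.+1) %% k)%N.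
(* The origin of x falls at place d of block q, so [u] is v recentred at q; its values outside the
   range of v do not matter. *)
rewrite k0 => dk pE; exists (Ordinal dk), (fun m => nth (x 0) v (absz (q%:Z + m))).
split=> [m mN|M MN].
  have -> : x m = nth (x 0) (subst_word phi v) (absz (p%:Z + N.+1%:Z + m)).
    have := xv (absz (N.+1%:Z + m)) ltac:(lia).
    have -> : - N.+1%:Z + (absz (N.+1%:Z + m))%:Z = m by lia.
    move=> ->; congr (nth _ _ _); lia.
  have [a [r [aE rk]]] := divz_eq_nat (m + d%:Z) k0.
  have a0 : 0 <= q%:Z + a by nia.
  have av : (absz (q%:Z + a)%R < size v)%N by nia.
  rewrite /shifted_iter /shiftz /= aE (subst_seqE phi_k _ _ (x 0) rk).
  rewrite -nth_subst_word //; congr (nth _ _ _).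
  have [e eE] : exists e : nat, q%:Z + a = e%:Z by exists (absz (q%:Z + a)%R); rewrite gez0_abs.
  rewrite eE absz_nat; have aq : a = e%:Z - q%:Z by lia.
  have sumE : p%:Z + N.+1%:Z + m = (k * e + r)%N%:Z.
    by move: aE; rewrite aq mulrBr; lia.
  by rewrite sumE absz_nat.
have Mq : (M < q)%N by rewrite -ltnS -(ltn_pmul2l k0) mulnS; nia.
have qv : (q + M < size v)%N by rewrite -(ltn_pmul2l k0) mulnDr; nia.
have {}qv : (q - M + (M + M).+1 <= size v)%N by lia.
exists b, n; apply/(factor_infixP (x 0)); exists (q - M)%N; split=> // j jM.
congr (nth _ _ _); lia.
Qed.

(** Some remainder d recurs, and the approximate preimages have a limit point along those indices:
    its windows are admissible, and continuity of T^d phi passes the equation to the limit. *)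
Lemma X_sub_desubst x : X x ->
  exists (d : nat) (u : int -> A), (d < k)%N /\ X u /\ x = op 1 d%:Z u.
Proof.
move=> Xx; have /choice[f fP] N := @X_sub_desubst_approx x N Xx.
have /choice[g gP] := fP.
have [d dP] : exists d, forall n0, exists n, (n0 <= n)%N /\ True /\ f n = d.
  by apply: infinite_pigeonhole => n0; exists n0.
have [|u uP] := @limit_point A g (fun n => f n = d).
  by move=> n0; have [n [? []]] := dP n0; exists n.
exists d, u; split; first exact: ltn_ord.
split=> [i l|].
  pose M := (`|i| + l)%N.
  have [n [Mn [fn un]]] := uP M (k * M.+2)%N.
  have [_ /(_ M Mn)[b [e /(factor_infixP (u 0))[p [pv gv]]]]] := gP n.
  exists b, e; apply/(factor_infixP (u 0)); exists (p + absz (M%:Z + i)%R)%N.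
  split; first by apply: leq_trans pv; lia.
  move=> j jl; rewrite un; last by lia.
  have := gv (absz (M%:Z + i)%R + j)%N ltac:(lia); rewrite addnA => <-.
  congr (g n _); lia.
apply: agree_on_all => N m mN.
have [n [Nn [fn un]]] := uP (N + absz (d : nat)%:Z)%N N.
have [xn _] := gP n; rewrite (shifted_iter_cont k_gt1 phi_k _ un mN) -fn.
apply: xn; lia.
Qed.

End SubstitutionSubshift.

(** * Forward and backward orbits of T^e phi^p, and digits of a desubstitution *)

Section Orbits.
Import GRing.Theory Num.Theory.
Local Open Scope ring_scope.

Variables (A : finType) (k : nat) (phi : A -> seq A).
Hypotheses (k_gt1 : (2 <= k)%N) (phi_k : constant_length k phi).
Local Notation op := (shifted_iter k phi).
Local Notation X := (X_sub phi).

(** Agreement on -1, 0, 1 spreads to agreement of the n-th and next iterates on [-n, n], so the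
    orbit converges; continuity makes the limit fixed. *)
Lemma shifted_iter_limit p (e : int) w :
  (0 < p)%N -> 0 <= e < (k ^ p)%N%:Z -> agree_on 1 w (op p e w) ->
  exists u, op p e u = u /\ forall N, agree_on N u (iter N (op p e) w).
Proof.
move=> p0 ep w1.
have step n : agree_on n (iter n (op p e) w) (iter n.+1 (op p e) w).
  by rewrite iterSr; apply: iter_shifted_iter_agree.
have steps n d : agree_on n (iter n (op p e) w) (iter (n + d) (op p e) w).
  elim: d => [|d IH]; first by rewrite addn0.
  rewrite addnS; apply: agree_on_trans IH _.
  by apply: (@agree_onW _ _ (n + d)); [exact: leq_addr|exact: step].
pose u (m : int) := iter `|m|%N (op p e) w m.
have uN N : agree_on N u (iter N (op p e) w).
  by move=> m mN; rewrite /u (steps _ (N - `|m|)%N) // subnKC.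
exists u; split=> //; apply: agree_on_all => N.
apply: agree_on_trans (shifted_iter_cont k_gt1 phi_k _ (uN _)) _.
rewrite -iterS; apply: agree_on_sym; apply: agree_onW (uN _); lia.
Qed.

(* Each T^e phi^p maps windows on {-1,0,1} to windows on {-1,0,1}, so these windows recur periodically along the backward orbit, and they determine [u 0] on ever larger intervals. *)
Lemma quasi_fixed_backward p (e : int) (u : nat -> int -> A) :
  (0 < p)%N -> 0 <= e < (k ^ p)%N%:Z -> (forall s, u s = op p e (u s.+1)) ->
  quasi_fixed k phi (u 0%N).
Proof.
move=> p0 ep uS.
have uD s n : u s = iter n (op p e) (u (s + n)%N).
  elim: n => [|n IH]; first by rewrite addn0.
  by rewrite IH (uS (s + n)%N) -iterSr addnS.
have [|a aP] := @infinite_pigeonhole _ (fun=> True) (fun s => window 1 (u s)).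
  by move=> n; exists n.
have [s1 [_ [_ us1]]] := aP 0%N; have [s2 [s12 [_ us2]]] := aP s1.+1.
pose q := (s2 - s1)%N.
have u0q : u 0%N = u q.
  (* Comparing a late index S carrying the recurrent window with s1 and s2 shows that u S and its
     q-th image agree on -1, 0, 1; applying the map S - q more times gives u q and u 0, which thus
     agree up to radius S - q >= N. *)
  apply: agree_on_all => N; have [S [NS [_ uS']]] := aP (N + q)%N.
  have cycle : agree_on 1 (u S) (iter q (op p e) (u S)).
    have [c cq E] := shifted_iter_exp k_gt1 phi_k ep q.
    have S2 : agree_on 1 (u s2) (u S) by apply/windowP; rewrite us2 uS'.
    have s1E : u s1 = iter q (op p e) (u s2) by rewrite (uD s1 q) subnKC // ltnW.
    have : agree_on 1 (u S) (u s1) by apply/windowP; rewrite us1 uS'.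
    move=> /agree_on_trans; apply; rewrite s1E !E => m m1.
    apply: (shifted_iter_agree k_gt1 phi_k cq S2).
    apply: leq_ltn_trans m1 _; rewrite -(expn0 k) ltn_exp2l //.
    by rewrite muln_gt0 p0 subn_gt0.
  have qS : (q + (S - q) = S)%N by rewrite subnKC //; apply: leq_trans NS; apply: leq_addl.
  rewrite (uD q (S - q)%N) qS (uD 0%N S) add0n -{1}qS addnC iterD.
  apply: (@agree_onW _ _ (S - q)); first by lia.
  by apply: iter_shifted_iter_agree => //; apply: agree_on_sym.
have [c cq E] := shifted_iter_exp k_gt1 phi_k ep q.
exists (p * q)%N, c; split; first by rewrite muln_gt0 p0 subn_gt0.
by rewrite -[LHS]/(op (p * q) c (u 0%N)) -E {1}u0q [RHS](uD 0%N q) add0n.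
Qed.

(* If [d] lists the successive digits of a desubstitution, x_i = T^{d i} phi(x_{i+1}), then x_i = T^{offset d i s} phi^s(x_{i+s}). *)
Fixpoint offset (d : nat -> nat) (i s : nat) : nat :=
  if s is s'.+1 then d i + k * offset d i.+1 s' else 0.

Lemma ltn_offset d i s : (forall j, (d j < k)%N) -> (offset d i s < k ^ s)%N.
Proof.
move=> dk; elim: s i => [|s IH] i //=; rewrite expnS.
by have := dk i; have := IH i.+1; nia.
Qed.

Lemma offsetD d i s t :
  offset d i (s + t) = (offset d i s + k ^ s * offset d (i + s) t)%N.
Proof.
elim: s i => [|s IH] i /=; first by rewrite mul1n addn0.
by rewrite IH expnS addSnnS mulnDr addnA mulnA.
Qed.

(** Splitting by [offsetD], the first t digits contribute equally and k^t cancels. *)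
Lemma offset_shift d i j : (forall s, offset d i s = offset d j s) ->
  forall t s, offset d (i + t) s = offset d (j + t) s.
Proof.
move=> ij t s; have kt : (0 < k ^ t)%N by rewrite expn_gt0; lia.
apply/eqP; rewrite -(eqn_pmul2l kt) -(eqn_add2l (offset d i t)) -offsetD.
by rewrite {1}ij offsetD ij.
Qed.

Lemma desubst_tower x : X x -> exists (xs : nat -> int -> A) (d : nat -> nat),
  [/\ xs 0%N = x, forall i, X (xs i), forall i, (d i < k)%N &
      forall i s, xs i = op s (offset d i s)%:Z (xs (i + s)%N)].
Proof.
move=> Xx.
(* Desubstitution is chosen as a total function, with a dummy value off [X], so that it can be
   iterated. *)
have /choice[g gP] (w : int -> A) : exists du : nat * (int -> A), X w ->
    (du.1 < k)%N /\ X du.2 /\ w = op 1 du.1%:Z du.2.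
  have [Xw|nX] := pselect (X w); last by exists (0%N, w).
  have [d [u [dk [Xu wE]]]] := X_sub_desubst k_gt1 phi_k Xw.
  by exists (d, u).
pose xs i := iter i (fun w => (g w).2) x.
have Xxs i : X (xs i) by elim: i => //= i /gP[_ []].
exists xs, (fun i => (g (xs i)).1); split=> // [i|i s].
  by have [] := gP _ (Xxs i).
elim: s i => [|s IH] i /=; first by rewrite addn0 shifted_iter0.
have [_ [_ {1}->]] := gP _ (Xxs i); rewrite -[(g (xs i)).2]/(xs i.+1) (IH i.+1).
by rewrite shifted_iterD // expn1 add1n addSnnS PoszD PoszM.
Qed.

End Orbits.

(** * A criterion for automaticity *)

Section Automatic.
Import GRing.Theory Num.Theory.
Local Open Scope ring_scope.

(* [z] need not be given as a fixed point: tau and the coding are read off from its values, with arbitrary choices on letters that do not occur. *)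
Lemma automatic_of_determined (B : Type) (C : finType) (k : nat)
    (z : int -> C) (y : int -> B) : (0 < k)%N ->
  (forall n n' r, (r < k)%N -> z n = z n' ->
    z (k%:Z * n + r%:Z) = z (k%:Z * n' + r%:Z)) ->
  (forall n n', z n = z n' -> y n = y n') ->
  automatic k y.
Proof.
move=> k0 zk zy.
have /choice[tau tauP] (c : C) : exists v : seq C, size v = k /\
    forall n, z n = c -> v = mkseq (fun r => z (k%:Z * n + r%:Z)) k.
  have [[n zn]|nz] := pselect (exists n, z n = c); last first.
    exists (nseq k c); split=> [|n zn]; first exact: size_nseq.
    by case: nz; exists n.
  exists (mkseq (fun r => z (k%:Z * n + r%:Z)) k); split=> [|n' zn'].
    exact: size_mkseq.
  apply/eq_in_map => r; rewrite mem_iota => rk; apply: zk => //.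
  by rewrite zn zn'.
have /choice[f fP] (c : C) : exists b, forall n, z n = c -> y n = b.
  have [[n zn]|nz] := pselect (exists n, z n = c); last first.
    by exists (y 0) => n zn; case: nz; exists n.
  by exists (y n) => n' zn'; apply: zy; rewrite zn zn'.
have tau_k : constant_length k tau by move=> c; have [] := tauP c.
exists C, tau, z, f; split=> //; split=> [|n]; last exact: fP.
apply: funext => m; have [q [r [-> rk]]] := divz_eq_nat m k0.
rewrite (subst_seqE tau_k _ _ (z 0) rk).
by have [_ /(_ q erefl)->] := tauP (z q); rewrite nth_mkseq.
Qed.

End Automatic.

(** * The factor map as a block code; images of quasi-fixed points *)

Section FactorMap.
Import GRing.Theory Num.Theory.
Local Open Scope ring_scope.

Variables (A B : finType) (k : nat) (phi : A -> seq A).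
Variables (Y : (int -> B) -> Prop) (pi : (int -> A) -> (int -> B)).
Hypotheses (k_gt1 : (2 <= k)%N) (phi_k : constant_length k phi).
Hypothesis piP : factor_map (X_sub phi) Y pi.
Local Notation op := (shifted_iter k phi).
Local Notation X := (X_sub phi).

Lemma factor_map_shift (c : int) x : X x -> pi (shiftz c x) = shiftz c (pi x).
Proof.
have [_ [_ [_ pi1]]] := piP.
have pi_nat (n : nat) u : X u -> pi (shiftz n%:Z u) = shiftz n%:Z (pi u).
  elim: n u => [|n IH] u Xu; first by rewrite !shiftz0.
  rewrite -addn1 PoszD -shiftzD IH; last exact: X_sub_shift.
  by rewrite pi1 // shiftzD.
case: (intP c) => [|n|n] Xx; [exact: pi_nat|exact: pi_nat|].
have {2}-> : x = shiftz n.+1%:Z (shiftz (- n.+1%:Z) x).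
  by rewrite shiftzD subrr shiftz0.
rewrite pi_nat; last exact: X_sub_shift.
by rewrite shiftzD addNr shiftz0.
Qed.

(** Curtis-Hedlund-Lyndon: if every radius failed at coordinate 0, continuity of [pi] would fail at
    a limit point of the failing pairs; shifts reach the other coordinates. *)
Lemma factor_map_block : exists N : nat, forall x u, X x -> X u ->
  forall n n' : int, agree_on N (shiftz n x) (shiftz n' u) -> pi x n = pi u n'.
Proof.
have [_ [_ [pi_cont _]]] := piP.
suff [N NP] : exists N, forall x u, X x -> X u -> agree_on N x u -> pi x 0 = pi u 0.
  exists N => x u Xx Xu n n' xu.
  have := NP _ _ (X_sub_shift n Xx) (X_sub_shift n' Xu) xu.
  by rewrite !factor_map_shift // /shiftz !add0r.
apply: contrapT => /forallNP nN.
have /choice[g gP] N : exists xu : (int -> A) * (int -> A),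
    [/\ X xu.1, X xu.2, agree_on N xu.1 xu.2 & pi xu.1 0 <> pi xu.2 0].
  apply: contrapT => /forallNP nxu; apply: (nN N) => x u Xx Xu xu.
  by apply: contrapT => pixu; apply: (nxu (x, u)).
have [|v vP] := @limit_point A (fun n => (g n).1) (fun=> True).
  by move=> n; exists n.
have Xv : X v.
  apply: X_sub_closed => N; have [n [_ [_ vn]]] := vP N N.
  by exists (g n).1; split=> //; have [] := gP n.
have [N NP] := pi_cont v Xv 0; have [n [Nn [_ vn]]] := vP N N.
have [Xx Xu xu] := gP n; apply; rewrite (NP _ Xx vn) (NP _ Xu) //.
by apply: agree_on_trans vn _; apply: agree_onW xu.
Qed.

(** The letter [z n] records the windows at n of x, phi(x), ..., phi^(m-1)(x). Applying phi moves
    each to the next, and T^c phi^m(x) = x closes the cycle. *)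
Lemma automatic_of_quasi_fixed x : X x -> quasi_fixed k phi x -> automatic k (pi x).
Proof.
move=> Xx [m [c [m1 xE]]]; have [N NP] := factor_map_block.
(* Radius N is what [pi] reads; the rest absorbs the shift c and rounding, since pulling back
   through phi divides distances by k >= 2. *)
pose L := (N + absz c + 4)%N.
pose z (n : int) : {ffun 'I_m -> {ffun 'I_(L + L).+1 -> A}} :=
  [ffun i : 'I_m => window L (shiftz n (op i 0 x))].
have zP n n' : z n = z n' ->
    forall i, (i < m)%N -> agree_on L (shiftz n (op i 0 x)) (shiftz n' (op i 0 x)).
  by move=> /ffunP zn i im; apply/windowP; have := zn (Ordinal im); rewrite !ffunE.
have k0 : (0 < k)%N by lia.
apply: (@automatic_of_determined B _ k z _ k0) => [n n' r rk zn|n n' zn]; last first.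
  apply: NP => //; have := zP _ _ zn _ m1; rewrite shifted_iter0.
  by apply: agree_onW; rewrite /L; lia.
apply/ffunP => -[i im]; rewrite !ffunE; apply/windowP => /=.
(* Level 0 comes from level m - 1 with shift c, any other level i from level i - 1 without shift. *)
have [j [c' [jm c'c E]]] : exists (j : nat) (c' : int),
    [/\ (j < m)%N, (absz c' <= absz c)%N & op i 0 x = op 1 c' (op j 0 x)].
  case: i im => [|i] im.
    exists m.-1, c; split=> //; first by lia.
    rewrite shifted_iter0 -{1}xE shifted_iterD // mulr0 addr0 add1n prednK //.
  exists i, 0; split=> //; first by lia.
  by rewrite shifted_iterD // mulr0 addr0.
have EE (n0 : int) : shiftz (k%:Z * n0 + r%:Z) (op i 0 x) =
    shiftz r%:Z (op 1 c' (shiftz n0 (op j 0 x))).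
  by rewrite shifted_iter_shift // expn1 shiftzD addrC E.
rewrite !EE => s sL; rewrite /shiftz; apply: shifted_iter_local => // q.
rewrite expn1 => qs; apply: (zP _ _ zn _ jm); rewrite /L in sL *.
nia.
Qed.

(** * The fiber over a single point [y] *)

Section Fiber.
Variable y : int -> B.

(** This is the set W_i, for an arbitrary shift [c]. *)
Definition level_fiber (i : nat) (c : int) (w : int -> A) : Prop :=
  X w /\ pi (op i c w) = y.

(* Whether [w] lies in the fiber is decided block by block from a window of [w] of bounded width and one letter of [z], because y on a block of level [i] is f(tau^i(z n)). *)
Lemma level_fiber_finite : automatic k y ->
  exists (S : finType) (r : nat -> int -> S), forall i j (c d : int),
    0 <= c < (k ^ i)%N%:Z -> 0 <= d < (k ^ j)%N%:Z -> r i c = r j d ->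
    forall w, level_fiber i c w -> level_fiber j d w.
Proof.
move=> [C [tau [z [f [tau_k [zE yE]]]]]]; have [N NP] := factor_map_block.
pose block i c w n := forall t : nat, (t < k ^ i)%N ->
  pi (op i c w) t%:Z = y ((k ^ i)%N%:Z * n + t%:Z).
have blockP i c w : X w ->
    pi (op i c w) = y <-> forall n, block i c (shiftz n w) n.
  move=> Xw; have shE (n : int) (t : nat) : pi (op i c (shiftz n w)) t%:Z =
      pi (op i c w) ((k ^ i)%N%:Z * n + t%:Z).
    rewrite shifted_iter_shift // factor_map_shift; last exact: X_sub_shifted_iter.
    by rewrite /shiftz addrC.
  split=> [wE n t _|bl]; first by rewrite shE wE.
  apply: funext => m; have ki : (0 < k ^ i)%N by rewrite expn_gt0; lia.
  by have [q [t [-> ti]]] := divz_eq_nat m ki; rewrite -shE bl.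
have z_iter i : iter i (subst_seq k tau) z = z by elim: i => //= i ->.
(* Reading a block with radius N involves places within N of a subset of [0, 2 k^i); these lie over
   letters at distance at most N + 1. *)
have block_local i (c : int) w u n n' : 0 <= c < (k ^ i)%N%:Z -> X w -> X u ->
    agree_on N.+2 w u -> z n = z n' -> block i c w n -> block i c u n'.
  move=> ci Xw Xu wu zn bl t ti; have := bl t ti.
  rewrite !yE -(z_iter i) (iter_subst_local k_gt1 tau_k zn ti) => <-.
  apply: NP; [exact: X_sub_shifted_iter|exact: X_sub_shifted_iter|].
  move=> s sN; rewrite /shiftz; apply: shifted_iter_local => // q qs.
  by rewrite wu //; nia.
(* [r i c] collects the pairs (window, letter of [z]) realised by a good block; by [block_local],
   every block with such a pair is then good. *)
exists {set {ffun 'I_(N.+2 + N.+2).+1 -> A} * C},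
  (fun i c => [set ab | `[< exists w n,
     [/\ X w, window N.+2 w = ab.1, z n = ab.2 & block i c w n] >]]).
move=> i j c d ci dj rE w [Xw /blockP wi]; split=> //.
apply/blockP => // n; have {}wi := wi Xw n.
have Xwn := X_sub_shift n Xw.
have : exists w' n', [/\ X w', window N.+2 w' = window N.+2 (shiftz n w),
    z n' = z n & block j d w' n'].
  move/setP/(_ (window N.+2 (shiftz n w), z n)): rE; rewrite !inE => rE.
  by apply/asboolP; rewrite -rE; apply/asboolP; exists (shiftz n w), n.
by move=> [w' [n' [Xw' /windowP w'w zn' bl]]]; apply: block_local bl.
Qed.

Lemma level_fiber_closed i (c : int) u :
  (forall N, exists w, level_fiber i c w /\ agree_on N u w) -> level_fiber i c u.
Proof.
move=> uW; have Xu : X u.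
  by apply: X_sub_closed => N; have [w [[Xw _] uw]] := uW N; exists w.
split=> //; apply: funext => m; have [N NP] := factor_map_block.
have [w [[Xw <-] uw]] := uW (N + absz m + absz c)%N.
apply: NP; [exact: X_sub_shifted_iter|exact: X_sub_shifted_iter|].
move=> s sN; rewrite /shiftz; apply: (shifted_iter_cont k_gt1 phi_k _ uw).
by lia.
Qed.

Lemma level_fiber_comp i p (c e : int) w :
  level_fiber (i + p) (c + (k ^ i)%N%:Z * e) w -> level_fiber i c (op p e w).
Proof.
by move=> [Xw wy]; split; [exact: X_sub_shifted_iter|rewrite shifted_iterD].
Qed.

Lemma level_fiber_tower x : X x -> pi x = y ->
  exists (xs : nat -> int -> A) (d : nat -> nat),
  [/\ xs 0%N = x, forall i, (d i < k)%N,
      forall i s, xs i = op s (offset k d i s)%:Z (xs (i + s)%N) &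
      forall i, level_fiber i (offset k d 0 i)%:Z (xs i)].
Proof.
move=> Xx xy; have [xs [d [xs0 Xxs dk xsE]]] := desubst_tower k_gt1 phi_k Xx.
by exists xs, d; split=> // i; split=> //; rewrite -[in LHS](add0n i) -xsE xs0.
Qed.

(* By pigeonhole, levels [i] and [i + p] have the same fiber for arbitrarily large [p]; the map carrying level [i + p] down to level [i] then sends this common fiber into itself. *)
Lemma level_fiber_recurrent (d : nat -> nat) : automatic k y ->
  (forall i, (d i < k)%N) ->
  exists i, forall n0, exists2 p, (n0 <= p)%N &
    (forall w, level_fiber i (offset k d 0 i)%:Z w ->
      level_fiber i (offset k d 0 i)%:Z (op p (offset k d i p)%:Z w)) /\
    (forall w, level_fiber (i + p) (offset k d 0 (i + p))%:Z w ->
      level_fiber i (offset k d 0 i)%:Z w).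
Proof.
move=> yk dk; have [S [r rP]] := level_fiber_finite yk.
have [|a aP] := @infinite_pigeonhole S (fun=> True) (fun i => r i (offset k d 0 i)%:Z).
  by move=> n; exists n.
have off_lt j : 0 <= (offset k d 0 j)%:Z < (k ^ j)%N%:Z.
  by rewrite /= ltz_nat ltn_offset.
have [i [_ [_ ia]]] := aP 0%N; exists i => n0.
have [j [ij [_ ja]]] := aP (i + n0)%N.
exists (j - i)%N; first by lia.
have jE : (i + (j - i) = j)%N by lia.
rewrite jE; split=> w wW; last by apply: (rP j i) wW; rewrite // ja ia.
apply: level_fiber_comp; have -> : (offset k d 0 i)%:Z + (k ^ i)%N%:Z *
    (offset k d i (j - i))%:Z = (offset k d 0 j)%:Z.
  by rewrite -{2}jE offsetD add0n PoszD PoszM.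
by rewrite jE; apply: (rP i j) wW; rewrite // ja ia.
Qed.

Lemma quasi_fixed_in_fiber x : automatic k y -> X x -> pi x = y ->
  exists u, X u /\ quasi_fixed k phi u /\ pi u = y.
Proof.
move=> yk Xx xy; have [xs [d [_ dk _ xsW]]] := level_fiber_tower Xx xy.
have [i /(_ 1%N)[p p0 [Wp _]]] := level_fiber_recurrent yk dk.
set c := (offset k d 0 i)%:Z in Wp *; set e := (offset k d i p)%:Z in Wp.
have ep : 0 <= e < (k ^ p)%N%:Z by rewrite /= ltz_nat ltn_offset.
have WpN n w : level_fiber i c w -> level_fiber i c (iter n (op p e) w).
  by move=> wW; elim: n => //= n; apply: Wp.
have [|a aP] := @infinite_pigeonhole _ (fun=> True)
    (fun n => window 1 (iter n (op p e) (xs i))).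
  by move=> n; exists n.
have [n1 [_ [_ n1a]]] := aP 0%N; have [n2 [n12 [_ n2a]]] := aP n1.+1.
pose q := (n2 - n1)%N; have q0 : (0 < q)%N by rewrite subn_gt0.
(* Starting where a window repeats, w and its image under the q-th power agree on -1, 0, 1, so the
   iterates of that power converge to a fixed point. *)
pose w := iter n1 (op p e) (xs i).
have wW : level_fiber i c w by apply: WpN; exact: xsW.
have [c' c'q E] := shifted_iter_exp k_gt1 phi_k ep q.
have cycle : agree_on 1 w (op (p * q) c' w).
  by apply/windowP; rewrite -E /w -iterD subnK ?n1a ?n2a // ltnW.
have pq0 : (0 < p * q)%N by rewrite muln_gt0 p0.
have [u [uE uw]] := shifted_iter_limit k_gt1 phi_k pq0 c'q cycle.
have [Xu uy] : level_fiber i c u.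
  apply: level_fiber_closed => N; exists (iter N (op (p * q) c') w).
  split; last exact: uw.
  by elim: N => //= N; rewrite -E; apply: WpN.
exists (op i c u); split; first exact: X_sub_shifted_iter.
by split=> //; apply: quasi_fixed_shifted_iter => //; exists (p * q)%N, c'.
Qed.

Lemma periodic_shift (S : Type) (c : int) (x : int -> S) :
  c != 0 -> shiftz c x = x -> periodic x.
Proof.
move=> c0 xE; exists (absz c); split; first by lia.
have [->|->] : (absz c)%:Z = c \/ (absz c)%:Z = - c by lia.
  exact: xE.
by rewrite -[in LHS]xE shiftzD addNr shiftz0.
Qed.

(* Two such images of one point differ by a shift, so [y] would equal a nontrivial shift of itself. *)
Lemma level_fiber_shift_uniq i s (c a b : int) w : ~ periodic y -> X w ->
  level_fiber i c (op s a w) -> level_fiber i c (op s b w) -> a = b.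
Proof.
move=> y_np Xw [_ ay] [_ by_]; apply/eqP; apply: contrapT => /negP ab.
apply: y_np; apply: (@periodic_shift _ ((k ^ i)%N%:Z * (b - a))).
  have : (0 < k ^ i)%N by rewrite expn_gt0; lia.
  by rewrite mulf_eq0 subr_eq0 [b == a]eq_sym (negbTE ab) orbF; lia.
rewrite -{1}ay -factor_map_shift; last by do 2 apply: X_sub_shifted_iter => //.
rewrite -shifted_iter_shift // -by_; congr (pi (op i c _)).
by rewrite /shifted_iter shiftzD subrK.
Qed.

(** Once the digits are periodic, every p-th point of the tower forms a backward orbit of one map
    T^e phi^p, as [quasi_fixed_backward] requires. *)
Lemma quasi_fixed_fiber x : automatic k y -> ~ periodic y -> X x -> pi x = y ->
  quasi_fixed k phi x.
Proof.
move=> yk y_np Xx xy; have [xs [d [xs0 dk xsE xsW]]] := level_fiber_tower Xx xy.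
have [i iP] := level_fiber_recurrent yk dk.
have [p p0 [Wp _]] := iP 1%N.
set c := (offset k d 0 i)%:Z in iP Wp.
(* Composing the return maps of times [p] and [Q] in both orders lands in the same fiber, so the two shifts agree; this forces the digits to have period [p] from level [i] on. *)
have offE s : offset k d i s = offset k d (i + p) s.
  (* Q >= p + s leaves s digits after the first p. The tower point at level i + Q also lies in the
     fiber of level i, so both return maps apply to it. *)
  have [Q Qps [WQ Wdown]] := iP (p + s)%N.
  have uW : level_fiber i c (xs (i + Q)%N) by apply: Wdown; exact: xsW.
  have [Xu _] := uW.
  have := WQ _ (Wp _ uW); have := Wp _ (WQ _ uW).
  rewrite !shifted_iterD // [(Q + p)%N]addnC => W1 W2.
  have := level_fiber_shift_uniq y_np Xu W1 W2.
  have -> : Q = (p + (s + (Q - (p + s))))%N by lia.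
  set t := (Q - (p + s))%N; move=> comm.
  (* Splitting the first p digits off [offset k d i Q] on the right cancels [offset k d i p], and
     then k^p. *)
  have {}comm : offset k d i (p + (s + t)) = (offset k d (i + p) (s + t) +
      k ^ (s + t) * offset k d i p)%N.
    have kp : (0 < k ^ p)%N by rewrite expn_gt0; lia.
    apply/eqP; rewrite -(eqn_pmul2l kp) mulnDr mulnA -expnD; apply/eqP.
    by have := offsetD k d i p (s + t); lia.
  have modE j m n : offset k d j (m + n) = offset k d j m %[mod k ^ m].
    by rewrite offsetD addnC mulnC modnMDl.
  have small j m : (offset k d j m %% k ^ m)%N = offset k d j m.
    by rewrite modn_small // ltn_offset.
  (* Modulo k^s only the first s digits survive on each side. *)
  rewrite -(small i) -(small (i + p)%N) -(modE (i + p)%N s t) -(modE i s (t + p)%N).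
  have -> : (s + (t + p) = p + (s + t))%N by lia.
  by rewrite comm expnD -mulnA addnC [(k ^ s * _)%N]mulnC modnMDl.
have offs s : offset k d (i + s * p) p = offset k d i p.
  elim: s => [|s IH]; first by rewrite addn0.
  by rewrite mulSn addnA -(offset_shift k_gt1 offE) IH.
have ep : 0 <= (offset k d i p)%:Z < (k ^ p)%N%:Z by rewrite /= ltz_nat ltn_offset.
rewrite -xs0 (xsE 0%N i); apply: quasi_fixed_shifted_iter => //.
rewrite add0n -[in xs i](addn0 i).
apply: (@quasi_fixed_backward _ _ _ k_gt1 phi_k p _ (fun s => xs (i + s * p)%N) p0 ep).
by move=> s; rewrite (xsE (i + s * p)%N p) offs -addnA -mulSnr.
Qed.

End Fiber.
End FactorMap.

Theorem theorem3p1 (A B : finType) (k : nat) (phi : A -> seq A)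
  (Y : (int -> B) -> Prop) (pi : (int -> A) -> (int -> B)) :
  (2 <= k)%N -> constant_length k phi -> growing phi ->
  subshift Y -> factor_map (X_sub phi) Y pi ->
  (forall y, Y y ->
     (automatic k y <-> exists x, X_sub phi x /\ quasi_fixed k phi x /\ pi x = y)) /\
  (forall y, Y y -> automatic k y -> ~ periodic y ->
     forall x, X_sub phi x -> pi x = y -> quasi_fixed k phi x).
Proof.
move=> k_gt1 phi_k _ _ piP; split=> [y Yy|y _ yk y_np x Xx xy]; last first.
  exact: (quasi_fixed_fiber k_gt1 phi_k piP yk y_np Xx xy).
split=> [yk|[x [Xx [xq <-]]]].
  have [_ [/(_ y Yy)[x [Xx xy]] _]] := piP.
  exact: (quasi_fixed_in_fiber k_gt1 phi_k piP yk Xx xy).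
exact: (automatic_of_quasi_fixed k_gt1 phi_k piP Xx xq).
Qed.
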